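(* Let $(M,\Delta,S)$ be a generalized counital $C^*$-bialgebra with target and source Cartan subalgebras $N_t$, $N_s$. Let $\theta_t$ be the trace of the left regular representation of $N_t$ (i.e. $\theta_t(n)=\mathrm{Tr}(m\mapsto nm)$ on $N_t$) and put $\varepsilon:=\theta_t\circ\varepsilon_t:M\to\mathbb{C}$. Then $(M,\Delta,S,\varepsilon)$ is a weak Kac algebra if and only if $(\mathrm{id}\otimes\varepsilon)\circ\Delta=\mathrm{id}$.
   Context: All algebras are finite-dimensional over $\mathbb{C}$; $\varsigma$ denotes the flip and $\mu(x\otimes y)=xy$. A generalized coinvolutive $C^*$-bialgebra is a triple $(M,\Delta,S)$ where $M$ is a finite-dimensional $C^*$-algebra; $\Delta:M\to M\otimes M$ is an injective, not necessarily unital, $*$-homomorphism with $(\Delta\otimes\mathrm{id})\Delta=(\mathrm{id}\otimes\Delta)\Delta$; and $S:M\to M$ is a linear, unital, antimultiplicative, $*$-preserving bijection with $S^2=\mathrm{id}$ and $(S\otimes S)\circ\Delta=\varsigma\circ\Delta\circ S$. Let $e=\Delta(1)$, $N_t=\{x:\Delta(x)=e(x\otimes1)=(x\otimes1)e\}$, $N_s=\{x:\Delta(x)=e(1\otimes x)=(1\otimes x)e\}$, $\varepsilon_t=\mu(\mathrm{id}\otimes S)\Delta$, $\varepsilon_s=\mu(S\otimes\mathrm{id})\Delta$. It is called counital if $\varepsilon_t(1)=1$, $\varepsilon_t(M)\subset N_t$, and $(\mathrm{id}\otimes\varepsilon_t)\Delta(x)=e(x\otimes1)$ for all $x\in N_s$.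 A weak Kac algebra is a quadruple $(M,\Delta,S,\varepsilon)$ with $(M,\Delta,S)$ a generalized coinvolutive $C^*$-bialgebra and $\varepsilon:M\to\mathbb{C}$ linear with $(\varepsilon\otimes\mathrm{id})\Delta=(\mathrm{id}\otimes\varepsilon)\Delta=\mathrm{id}$, $\varepsilon\circ S=\varepsilon$, $\varepsilon(x^* )=\overline{\varepsilon(x)}$, $(\varepsilon\otimes\varepsilon)((x\otimes1)e(1\otimes y))=\varepsilon(xy)$ for all $x,y$, and $(\varepsilon_s\otimes\mathrm{id})\Delta(x)=(1\otimes x)e$ for all $x$. *)

(* Defs.v *)
(* Tensor products M (x) M are represented in coordinates w.r.t. the canonical
   basis [vbasis {:M}] of M: an element  sum_{i,j} T i j  b_i (x) b_j  of M (x) M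
   is the square matrix T. *)
From HB Require Import structures.
From mathcomp Require Import all_boot all_order all_algebra all_field.
From mathcomp Require Import complex.
From mathcomp Require Import reals.

Set Implicit Arguments.
Unset Strict Implicit.
Unset Printing Implicit Defensive.

Import Order.TTheory GRing.Theory Num.Theory.
Local Open Scope ring_scope.

Section WeakKac.
Variable R : realType.
Variable M : falgType R[i].

Local Notation n := (\dim (fullv : {vspace M})).

Definition bM : n.-tuple M := vbasis fullv.
Definition bv (i : 'I_n) : M := tnth bM i.

Definition tens (x y : M) : 'M[R[i]]_n :=
  \matrix_(i, j) (coord bM i x * coord bM j y).

(* product on M (x) M : (x (x) y)(x' (x) y') = x x' (x) y y' *)
Definition tmul (T U : 'M[R[i]]_n) : 'M[R[i]]_n :=
  \sum_(i < n) \sum_(j < n) \sum_(k < n) \sum_(l < n)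
     (T i j * U k l) *: tens (bv i * bv k) (bv j * bv l).

Definition tmap (f g : M -> M) (T : 'M[R[i]]_n) : 'M[R[i]]_n :=
  \sum_(i < n) \sum_(j < n) T i j *: tens (f (bv i)) (g (bv j)).

(* involution on M (x) M : (x (x) y)^* = x^* (x) y^* *)
Definition tstar (s : M -> M) (T : 'M[R[i]]_n) : 'M[R[i]]_n :=
  \sum_(i < n) \sum_(j < n) conjc (T i j) *: tens (s (bv i)) (s (bv j)).

Definition tflip (T : 'M[R[i]]_n) : 'M[R[i]]_n := T^T.

Definition tmu (T : 'M[R[i]]_n) : M :=
  \sum_(i < n) \sum_(j < n) T i j *: (bv i * bv j).

Definition id_tens_fun (f : M -> R[i]) (T : 'M[R[i]]_n) : M :=
  \sum_(i < n) \sum_(j < n) (T i j * f (bv j)) *: bv i.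
Definition fun_tens_id (f : M -> R[i]) (T : 'M[R[i]]_n) : M :=
  \sum_(i < n) \sum_(j < n) (T i j * f (bv i)) *: bv j.

Definition fun_tens_fun (f g : M -> R[i]) (T : 'M[R[i]]_n) : R[i] :=
  \sum_(i < n) \sum_(j < n) T i j * f (bv i) * g (bv j).

(* coassociativity (Delta (x) id) Delta = (id (x) Delta) Delta,
   compared coefficientwise on b_i (x) b_j (x) b_k *)
Definition coassociative (D : M -> 'M[R[i]]_n) : Prop :=
  forall x i j k,
    \sum_(p < n) D x p k * D (bv p) i j = \sum_(q < n) D x i q * D (bv q) j k.

Definition is_linear_map (f : M -> M) : Prop :=
  forall (a : R[i]) x y, f (a *: x + y) = a *: f x + f y.
Definition is_linear_tmap (f : M -> 'M[R[i]]_n) : Prop :=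
  forall (a : R[i]) x y, f (a *: x + y) = a *: f x + f y.
Definition is_linear_functional (f : M -> R[i]) : Prop :=
  forall (a : R[i]) x y, f (a *: x + y) = a * f x + f y.

Definition star_algebra (s : M -> M) : Prop :=
  [/\ forall (a : R[i]) x y, s (a *: x + y) = conjc a *: s x + s y,
      forall x, s (s x) = x
    & forall x y, s (x * y) = s y * s x].

Definition cstar_norm (s : M -> M) (nrm : M -> R) : Prop :=
  (forall x, 0 <= nrm x) /\
  (forall x, nrm x = 0 -> x = 0) /\
  (forall x y, nrm (x + y) <= nrm x + nrm y) /\
  (forall (a : R[i]) x, nrm (a *: x) = ComplexField.Normc.normc a * nrm x) /\
  (forall x y, nrm (x * y) <= nrm x * nrm y) /\
  (forall x, nrm (s x * x) = nrm x ^+ 2).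

(* (M, s) is a (finite-dimensional, hence complete) C*-algebra *)
Definition cstar_algebra (s : M -> M) : Prop :=
  star_algebra s /\ exists nrm : M -> R, cstar_norm s nrm.

Definition gen_coinv_cstar_bialgebra (s : M -> M) (D : M -> 'M[R[i]]_n)
    (S : M -> M) : Prop :=
  [/\ cstar_algebra s,
      [/\ is_linear_tmap D, injective D,
          forall x y, D (x * y) = tmul (D x) (D y),
          forall x, D (s x) = tstar s (D x)
        & coassociative D],
      [/\ is_linear_map S, S 1 = 1,
          forall x y, S (x * y) = S y * S x,
          forall x, S (s x) = s (S x)
        & bijective S],
      forall x, S (S x) = x
    & forall x, tmap S S (D x) = tflip (D (S x))].

Definition unitD (D : M -> 'M[R[i]]_n) : 'M[R[i]]_n := D 1.

Definition in_Nt (D : M -> 'M[R[i]]_n) (x : M) : Prop :=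
  D x = tmul (unitD D) (tens x 1) /\ D x = tmul (tens x 1) (unitD D).
Definition in_Ns (D : M -> 'M[R[i]]_n) (x : M) : Prop :=
  D x = tmul (unitD D) (tens 1 x) /\ D x = tmul (tens 1 x) (unitD D).

Definition eps_t (D : M -> 'M[R[i]]_n) (S : M -> M) (x : M) : M :=
  tmu (tmap id S (D x)).
Definition eps_s (D : M -> 'M[R[i]]_n) (S : M -> M) (x : M) : M :=
  tmu (tmap S id (D x)).

Definition counital (D : M -> 'M[R[i]]_n) (S : M -> M) : Prop :=
  [/\ eps_t D S 1 = 1,
      forall x, in_Nt D (eps_t D S x)
    & forall x, in_Ns D x -> tmap id (eps_t D S) (D x) = tmul (unitD D) (tens x 1)].

(* N_t as a subspace of M (for Delta linear it is exactly {x | in_Nt D x}) *)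
Definition Nt_map (D : M -> 'M[R[i]]_n) (x : M) : 'M[R[i]]_n * 'M[R[i]]_n :=
  (D x - tmul (unitD D) (tens x 1), D x - tmul (tens x 1) (unitD D)).
Definition Nt_space (D : M -> 'M[R[i]]_n) : {vspace M} := lker (linfun (Nt_map D)).

(* theta_t(m) = trace of the left multiplication u |-> m u on N_t *)
Definition theta_t (D : M -> 'M[R[i]]_n) (m : M) : R[i] :=
  \sum_(i < \dim (Nt_space D))
     coord (vbasis (Nt_space D)) i (m * tnth (vbasis (Nt_space D)) i).

Definition weak_kac_algebra (s : M -> M) (D : M -> 'M[R[i]]_n) (S : M -> M)
    (eps : M -> R[i]) : Prop :=
  gen_coinv_cstar_bialgebra s D S /\
  is_linear_functional eps /\
  (forall x, fun_tens_id eps (D x) = x) /\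
  (forall x, id_tens_fun eps (D x) = x) /\
  (forall x, eps (S x) = eps x) /\
  (forall x, eps (s x) = conjc (eps x)) /\
  (forall x y, fun_tens_fun eps eps (tmul (tmul (tens x 1) (unitD D)) (tens 1 y))
               = eps (x * y)) /\
  (forall x, tmap (eps_s D S) id (D x) = tmul (tens 1 x) (unitD D)).

End WeakKac.

(* Main.v *)
(* Given the right counit property (id ⊗ ε)Δ = id, antipode
   covariance (S ⊗ S)Δ = ςΔS turns it into the left counit property, whence ε ∘ S = ε;
   compatibility of Δ with the involution s does the same for x ↦ conj (ε (s x)),
   whence ε (s x) = conj (ε x).  Weak multiplicativity follows from
   ε (x y) = ε (x ε_t(y)) and e (1 ⊗ z) = e (S z ⊗ 1) for z ∈ N_t.  Finally
   (ε_s ⊗ id)Δ(x) = (1 ⊗ x) e is the image under ς(S ⊗ S) of (id ⊗ ε_t)Δ(x) = e (x ⊗ 1),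
   which is checked against the functionals m ↦ ε (m w): these separate the points
   of N_t, since a = (ε ⊗ id)((a ⊗ 1) e) for a ∈ N_t. *)

Require Import Defs.
From HB Require Import structures.
From mathcomp Require Import all_boot all_order all_algebra all_field.
From mathcomp Require Import complex.
From mathcomp Require Import reals.

Set Implicit Arguments.
Unset Strict Implicit.
Unset Printing Implicit Defensive.

Import GRing.Theory.
Local Open Scope ring_scope.

Section LinearFor.
Variables (K : pzRingType) (U : lmodType K) (V : zmodType).
Variables (s : GRing.Scale.law K V) (f : U -> V) (f_lin : linear_for s f).

HB.instance Definition _ := GRing.isLinear.Build K U V s f f_lin.

Lemma linear_forB x y : f (x - y) = f x - f y. Proof. exact: linearB. Qed.
Lemma linear_forZ a x : f (a *: x) = s a (f x). Proof. exact: linearZ_LR. Qed.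
Lemma linear_for_sum I r (P : pred I) (F : I -> U) :
  f (\sum_(i <- r | P i) F i) = \sum_(i <- r | P i) f (F i).
Proof. exact: linear_sum. Qed.

End LinearFor.

Lemma linear_id (K : pzRingType) (U : lmodType K) : linear (@id U).
Proof. by []. Qed.
Arguments linear_id {K U}.

Section Tensors.
Variables (R : realType) (M : falgType R[i]).
Local Notation n := (\dim (fullv : {vspace M})).
Local Notation C := R[i].
Local Notation T := 'M[C]_n.
Local Notation coordM := (coord (bM M)).

Lemma coord_bv (i j : 'I_n) : coordM j (bv i) = (i == j)%:R.
Proof. by rewrite /bv (tnth_nth 0) coord_free //; exact: basis_free (vbasisP fullv). Qed.

Lemma sum_coord_bv (x : M) : \sum_i coordM i x *: bv i = x.
Proof.
rewrite [RHS](coord_vbasis (memvf x)); apply: eq_bigr => i _.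
by rewrite /bv (tnth_nth 0).
Qed.

Lemma tens_bv (i j : 'I_n) : tens (bv i) (bv j) = delta_mx i j.
Proof.
by apply/matrixP => k l; rewrite !mxE !coord_bv [k == i]eq_sym [l == j]eq_sym -natrM mulnb.
Qed.

Lemma sum_delta_mx (V : lmodType C) (F : 'I_n -> 'I_n -> V) (i j : 'I_n) :
  \sum_k \sum_l delta_mx i j k l *: F k l = F i j.
Proof.
rewrite (bigD1 i) //= (bigD1 j) //= mxE !eqxx scale1r.
rewrite big1 => [|l /negbTE lj]; last by rewrite mxE lj andbF scale0r.
rewrite addr0 big1 ?addr0 // => k /negbTE ki.
by rewrite big1 // => l _; rewrite mxE ki scale0r.
Qed.

Lemma tensPl (b : M) a (x y : M) : tens (a *: x + y) b = a *: tens x b + tens y b.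
Proof. by apply/matrixP => i j; rewrite !mxE linearD linearZ /= mulrDl mulrA. Qed.

Lemma tensPr (a : M) c (x y : M) : tens a (c *: x + y) = c *: tens a x + tens a y.
Proof. by apply/matrixP => i j; rewrite !mxE linearD linearZ /= mulrDr mulrCA. Qed.

Section Extensionality.
Variable V : lmodType C.

Lemma bilinear_ext (F G : M -> M -> V) :
    (forall b, linear (F ^~ b)) -> (forall a, linear (F a)) ->
    (forall b, linear (G ^~ b)) -> (forall a, linear (G a)) ->
    (forall i j, F (bv i) (bv j) = G (bv i) (bv j)) -> forall a b, F a b = G a b.
Proof.
move=> F1 F2 G1 G2 FG a b.
rewrite -(sum_coord_bv a) (linear_for_sum (F1 b)) (linear_for_sum (G1 b)).
apply: eq_bigr => i _; rewrite (linear_forZ (F1 b)) (linear_forZ (G1 b)).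
rewrite -(sum_coord_bv b) (linear_for_sum (F2 _)) (linear_for_sum (G2 _)).
by congr (_ *: _); apply: eq_bigr => j _; rewrite (linear_forZ (F2 _)) (linear_forZ (G2 _)) FG.
Qed.

Lemma tens_ext (f g : T -> V) : linear f -> linear g ->
  (forall a b, f (tens a b) = g (tens a b)) -> f =1 g.
Proof.
move=> hf hg fg A; rewrite (matrix_sum_delta A).
rewrite (linear_for_sum hf) (linear_for_sum hg); apply: eq_bigr => i _.
rewrite (linear_for_sum hf) (linear_for_sum hg); apply: eq_bigr => j _.
by rewrite (linear_forZ hf) (linear_forZ hg) -tens_bv fg.
Qed.

End Extensionality.

Lemma tmulPl (B : T) a (X Y : T) : tmul (a *: X + Y) B = a *: tmul X B + tmul Y B.
Proof.
rewrite /tmul scaler_sumr -big_split; apply: eq_bigr => i _.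
rewrite scaler_sumr -big_split; apply: eq_bigr => j _.
rewrite scaler_sumr -big_split; apply: eq_bigr => k _.
rewrite scaler_sumr -big_split; apply: eq_bigr => l _.
by rewrite !mxE mulrDl scalerDl scalerA mulrA.
Qed.

Lemma tmulPr (A : T) a (X Y : T) : tmul A (a *: X + Y) = a *: tmul A X + tmul A Y.
Proof.
rewrite /tmul scaler_sumr -big_split; apply: eq_bigr => i _.
rewrite scaler_sumr -big_split; apply: eq_bigr => j _.
rewrite scaler_sumr -big_split; apply: eq_bigr => k _.
rewrite scaler_sumr -big_split; apply: eq_bigr => l _.
by rewrite !mxE mulrDr scalerDl scalerA mulrCA.
Qed.

Lemma tmul_tens (a b c d : M) : tmul (tens a b) (tens c d) = tens (a * c) (b * d).
Proof.
move: a b; apply: (bilinear_ext (F := fun a b => _) (G := fun a b => _)) => [b|a|b|a|i j].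
- by move=> k x y; rewrite tensPl tmulPl.
- by move=> k x y; rewrite tensPr tmulPl.
- by move=> k x y; rewrite mulrDl -scalerAl tensPl.
- by move=> k x y; rewrite mulrDl -scalerAl tensPr.
move: c d; apply: (bilinear_ext (F := fun c d => _) (G := fun c d => _)) => [d|c|d|c|k l].
- by move=> r x y; rewrite tensPl tmulPr.
- by move=> r x y; rewrite tensPr tmulPr.
- by move=> r x y; rewrite mulrDr -scalerAr tensPl.
- by move=> r x y; rewrite mulrDr -scalerAr tensPr.
rewrite !tens_bv /tmul.
rewrite -(sum_delta_mx (fun p q => tens (bv p * bv k) (bv q * bv l)) i j).
apply: eq_bigr => p _; apply: eq_bigr => q _.
rewrite -(sum_delta_mx (fun r t => tens (bv p * bv r) (bv q * bv t)) k l).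
rewrite scaler_sumr; apply: eq_bigr => r _.
by rewrite scaler_sumr; apply: eq_bigr => t _; rewrite scalerA.
Qed.

Lemma tflipP a (X Y : T) : tflip (a *: X + Y) = a *: tflip X + tflip Y.
Proof. by rewrite /tflip linearD linearZ. Qed.

Definition tensor_map (V : lmodType C) (F : 'I_n -> 'I_n -> V) (A : T) : V :=
  \sum_i \sum_j A i j *: F i j.

Lemma tensor_mapP (V : lmodType C) (F : 'I_n -> 'I_n -> V) a (X Y : T) :
  tensor_map F (a *: X + Y) = a *: tensor_map F X + tensor_map F Y.
Proof.
rewrite /tensor_map scaler_sumr -big_split; apply: eq_bigr => i _.
by rewrite scaler_sumr -big_split; apply: eq_bigr => j _; rewrite !mxE scalerDl scalerA.
Qed.

Lemma tensor_map_tens (V : lmodType C) (G : M -> M -> V) (a b : M) :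
    (forall y, linear (G ^~ y)) -> (forall x, linear (G x)) ->
  tensor_map (fun i j => G (bv i) (bv j)) (tens a b) = G a b.
Proof.
move=> G1 G2; move: a b.
apply: (bilinear_ext (F := fun a b => _) (G := fun a b => _)) => //.
- by move=> y k x z; rewrite tensPl tensor_mapP.
- by move=> x k y z; rewrite tensPr tensor_mapP.
by move=> i j; rewrite tens_bv /tensor_map sum_delta_mx.
Qed.

Lemma tmapP (f g : M -> M) a (X Y : T) :
  tmap f g (a *: X + Y) = a *: tmap f g X + tmap f g Y.
Proof. exact: tensor_mapP. Qed.

Lemma tmuP a (X Y : T) : tmu (a *: X + Y) = a *: tmu X + tmu Y.
Proof. exact: tensor_mapP. Qed.

Lemma id_tens_funE (phi : M -> C) (A : T) :
  id_tens_fun phi A = tensor_map (fun i j => phi (bv j) *: bv i) A.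
Proof. by apply: eq_bigr => i _; apply: eq_bigr => j _; rewrite scalerA. Qed.

Lemma fun_tens_idE (phi : M -> C) (A : T) :
  fun_tens_id phi A = tensor_map (fun i j => phi (bv i) *: bv j) A.
Proof. by apply: eq_bigr => i _; apply: eq_bigr => j _; rewrite scalerA. Qed.

Lemma id_tens_funP (phi : M -> C) a (X Y : T) :
  id_tens_fun phi (a *: X + Y) = a *: id_tens_fun phi X + id_tens_fun phi Y.
Proof. by rewrite !id_tens_funE tensor_mapP. Qed.

Lemma fun_tens_idP (phi : M -> C) a (X Y : T) :
  fun_tens_id phi (a *: X + Y) = a *: fun_tens_id phi X + fun_tens_id phi Y.
Proof. by rewrite !fun_tens_idE tensor_mapP. Qed.

Ltac linearity := let a := fresh "a" in let X := fresh "X" in let Y := fresh "Y" in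
  by move=> a X Y /=; rewrite ?(tensPl, tensPr, tmulPl, tmulPr, tflipP, tmapP, tmuP,
                             id_tens_funP, fun_tens_idP).

Lemma tmulA (A B E : T) : tmul (tmul A B) E = tmul A (tmul B E).
Proof.
move: A; apply: (tens_ext (f := fun A => _) (g := fun A => _)) => [||a b] /=; try linearity.
move: B; apply: (tens_ext (f := fun B => _) (g := fun B => _)) => [||c d] /=; try linearity.
move: E; apply: (tens_ext (f := fun E => _) (g := fun E => _)) => [||x y] /=; try linearity.
by rewrite !tmul_tens !mulrA.
Qed.
Lemma tmulr1 (A : T) : tmul A (tens 1 1) = A.
Proof.
move: A; apply: (tens_ext (f := fun A => _) (g := id)) => [||a b] /=; try linearity.
by rewrite tmul_tens !mulr1.
Qed.

Lemma tmul1r (A : T) : tmul (tens 1 1) A = A.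
Proof.
move: A; apply: (tens_ext (f := fun A => _) (g := id)) => [||a b] /=; try linearity.
by rewrite tmul_tens !mul1r.
Qed.

Lemma tflipK : involutive (@tflip R M). Proof. exact: trmxK. Qed.

Lemma tflip_tens (a b : M) : tflip (tens a b) = tens b a.
Proof. by apply/matrixP => i j; rewrite !mxE mulrC. Qed.

Lemma tflip_tmul (A B : T) : tflip (tmul A B) = tmul (tflip A) (tflip B).
Proof.
move: A; apply: (tens_ext (f := fun A => _) (g := fun A => _)) => [||a b] /=; try linearity.
move: B; apply: (tens_ext (f := fun B => _) (g := fun B => _)) => [||c d] /=; try linearity.
by rewrite !tflip_tens !tmul_tens tflip_tens.
Qed.

Lemma tmu_tens (a b : M) : tmu (tens a b) = a * b.
Proof.
apply: (tensor_map_tens (G := fun x y => x * y)) => [y k x z|x k y z] /=.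
  by rewrite mulrDl scalerAl.
by rewrite mulrDr scalerAr.
Qed.

Lemma tmap_tens (f g : M -> M) : linear f -> linear g ->
  forall a b, tmap f g (tens a b) = tens (f a) (g b).
Proof.
move=> f_lin g_lin a b.
apply: (tensor_map_tens (G := fun x y => tens (f x) (g y))) => [y k x z|x k y z] /=.
  by rewrite f_lin tensPl.
by rewrite g_lin tensPr.
Qed.

Lemma tmap_antimul (f : M -> M) : linear f -> (forall x y, f (x * y) = f y * f x) ->
  forall A B : T, tmap f f (tmul A B) = tmul (tmap f f B) (tmap f f A).
Proof.
move=> f_lin fM A B.
move: A; apply: (tens_ext (f := fun A => _) (g := fun A => _)) => [||a b] /=; try linearity.
move: B; apply: (tens_ext (f := fun B => _) (g := fun B => _)) => [||c d] /=; try linearity.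
by rewrite !(tmap_tens f_lin f_lin) !tmul_tens tmap_tens // !fM.
Qed.

Section Slices.
Variables (phi psi : M -> C).

Lemma eq_id_tens_fun (A : T) : phi =1 psi -> id_tens_fun phi A = id_tens_fun psi A.
Proof. by move=> eq_phi; apply: eq_bigr => i _; apply: eq_bigr => j _; rewrite eq_phi. Qed.

Lemma eq_fun_tens_id (A : T) : phi =1 psi -> fun_tens_id phi A = fun_tens_id psi A.
Proof. by move=> eq_phi; apply: eq_bigr => i _; apply: eq_bigr => j _; rewrite eq_phi. Qed.

Lemma id_tens_fun_tflip (A : T) : id_tens_fun phi (tflip A) = fun_tens_id phi A.
Proof.
rewrite /id_tens_fun /fun_tens_id exchange_big; apply: eq_bigr => i _.
by apply: eq_bigr => j _; rewrite mxE.
Qed.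

Hypothesis phi_lin : scalar phi.

Lemma id_tens_fun_tens (a b : M) : id_tens_fun phi (tens a b) = phi b *: a.
Proof.
rewrite id_tens_funE; apply: (tensor_map_tens (G := fun x y => phi y *: x)) => [y|x] k u v /=.
  by rewrite scalerDr !scalerA mulrC.
by rewrite phi_lin scalerDl scalerA.
Qed.

Lemma fun_tens_id_tens (a b : M) : fun_tens_id phi (tens a b) = phi a *: b.
Proof.
rewrite fun_tens_idE; apply: (tensor_map_tens (G := fun x y => phi x *: y)) => [y|x] k u v /=.
  by rewrite phi_lin scalerDl scalerA.
by rewrite scalerDr !scalerA mulrC.
Qed.

Lemma fun_tens_funE (A : T) : phi (id_tens_fun psi A) = fun_tens_fun phi psi A.
Proof.
rewrite (linear_for_sum phi_lin); apply: eq_bigr => i _.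
rewrite (linear_for_sum phi_lin); apply: eq_bigr => j _.
by rewrite (linear_forZ phi_lin) /= mulrAC.
Qed.

Lemma fun_tens_fun_idE (A : T) : phi (fun_tens_id psi A) = fun_tens_fun psi phi A.
Proof.
rewrite (linear_for_sum phi_lin); apply: eq_bigr => i _.
rewrite (linear_for_sum phi_lin); apply: eq_bigr => j _.
by rewrite (linear_forZ phi_lin).
Qed.

End Slices.

Lemma fun_tens_id_tmap (phi : M -> C) (f g : M -> M) (A : T) :
  scalar phi -> linear f -> linear g ->
  fun_tens_id phi (tmap f g A) = g (fun_tens_id (fun m => phi (f m)) A).
Proof.
move=> phi_lin f_lin g_lin.
move: A; apply: (tens_ext (f := fun A => _) (g := fun A => _)) => [||a b] /=; try linearity.
  by move=> k X Y; rewrite fun_tens_idP g_lin.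
rewrite (tmap_tens f_lin g_lin) !fun_tens_id_tens ?(linear_forZ g_lin) // => k x y.
by rewrite f_lin phi_lin.
Qed.

Lemma id_tens_fun_tmap (phi : M -> C) (g : M -> M) (A : T) : scalar phi -> linear g ->
  id_tens_fun phi (tmap id g A) = id_tens_fun (fun m => phi (g m)) A.
Proof.
move=> phi_lin g_lin.
move: A; apply: (tens_ext (f := fun A => _) (g := fun A => _)) => [||a b] /=; try linearity.
rewrite (tmap_tens linear_id g_lin) !id_tens_fun_tens // => k x y.
by rewrite g_lin phi_lin.
Qed.

Section SliceProducts.
Variables (phi : M -> C) (phi_lin : scalar phi).

Lemma id_tens_fun_tmull (x y : M) (A : T) :
  id_tens_fun phi (tmul (tens x y) A) = x * id_tens_fun (fun m => phi (y * m)) A.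
Proof.
move: A; apply: (tens_ext (f := fun A => _) (g := fun A => _)) => [||a b] /=; try linearity.
  by move=> k X Y; rewrite id_tens_funP mulrDr scalerAr.
rewrite tmul_tens !id_tens_fun_tens // => [|k u v]; first by rewrite scalerAr.
by rewrite mulrDr -scalerAr phi_lin.
Qed.

Lemma id_tens_fun_tmulr (x y : M) (A : T) :
  id_tens_fun phi (tmul A (tens x y)) = id_tens_fun (fun m => phi (m * y)) A * x.
Proof.
move: A; apply: (tens_ext (f := fun A => _) (g := fun A => _)) => [||a b] /=; try linearity.
  by move=> k X Y; rewrite id_tens_funP mulrDl scalerAl.
rewrite tmul_tens !id_tens_fun_tens // => [|k u v]; first by rewrite scalerAl.
by rewrite mulrDl -scalerAl phi_lin.
Qed.

Lemma id_tens_fun_tmull1 (x : M) (A : T) :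
  id_tens_fun phi (tmul (tens x 1) A) = x * id_tens_fun phi A.
Proof. by rewrite id_tens_fun_tmull; congr (_ * _); apply: eq_id_tens_fun => m; rewrite mul1r. Qed.

Lemma id_tens_fun_tmul1l (y : M) (A : T) :
  id_tens_fun phi (tmul (tens 1 y) A) = id_tens_fun (fun m => phi (y * m)) A.
Proof. by rewrite id_tens_fun_tmull mul1r. Qed.

Lemma id_tens_fun_tmulr1 (x : M) (A : T) :
  id_tens_fun phi (tmul A (tens x 1)) = id_tens_fun phi A * x.
Proof. by rewrite id_tens_fun_tmulr; congr (_ * _); apply: eq_id_tens_fun => m; rewrite mulr1. Qed.

Lemma id_tens_fun_tmul1r (y : M) (A : T) :
  id_tens_fun phi (tmul A (tens 1 y)) = id_tens_fun (fun m => phi (m * y)) A.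
Proof. by rewrite id_tens_fun_tmulr mulr1. Qed.

Lemma fun_tens_id_tmull1 (x : M) (A : T) :
  fun_tens_id phi (tmul (tens x 1) A) = fun_tens_id (fun m => phi (x * m)) A.
Proof.
move: A; apply: (tens_ext (f := fun A => _) (g := fun A => _)) => [||a b] /=; try linearity.
rewrite tmul_tens !fun_tens_id_tens // ?mul1r // => k u v.
by rewrite mulrDr -scalerAr phi_lin.
Qed.

Lemma id_tens_fun_tstar (s : M -> M) (A : T) :
    (forall a x y, s (a *: x + y) = conjc a *: s x + s y) ->
  id_tens_fun phi (tstar s A) = s (id_tens_fun (fun m => conjc (phi (s m))) A).
Proof.
move=> s_anti.
have sD x y : s (x + y) = s x + s y by have := s_anti 1 x y; rewrite conjc1 !scale1r.
have s0 : s 0 = 0 by apply: (addrI (s 0)); rewrite -sD !addr0.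
have sZ a x : s (a *: x) = conjc a *: s x by rewrite -[a *: x]addr0 s_anti s0 addr0.
rewrite /tstar (linear_for_sum (id_tens_funP phi)) (big_morph s sD s0).
apply: eq_bigr => i _; rewrite (linear_for_sum (id_tens_funP phi)) (big_morph s sD s0).
apply: eq_bigr => j _; rewrite (linear_forZ (id_tens_funP phi)) id_tens_fun_tens //.
by rewrite !sZ rmorphM /= conjcK scalerA.
Qed.

End SliceProducts.

Lemma tmap_id_tmul_tens1 (g : M -> M) (A : T) (x : M) : linear g ->
  tmap id g (tmul A (tens x 1)) = tmul (tmap id g A) (tens x 1).
Proof.
move=> g_lin.
move: A; apply: (tens_ext (f := fun A => _) (g := fun A => _)) => [||a b] /=; try linearity.
by rewrite tmul_tens !(tmap_tens linear_id g_lin) tmul_tens !mulr1.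
Qed.

Lemma fun_tens_fun_coord (A : T) (k l : 'I_n) :
  fun_tens_fun (coordM k) (coordM l) A = A k l.
Proof.
rewrite /fun_tens_fun (bigD1 k) //= [X in _ + X]big1 => [|i /negbTE ik]; last first.
  by rewrite big1 // => j _; rewrite coord_bv ik mulr0 mul0r.
rewrite addr0 (bigD1 l) //= [X in _ + X]big1 => [|j /negbTE jl]; last by rewrite !coord_bv jl mulr0.
by rewrite !coord_bv !eqxx !mulr1 addr0.
Qed.

End Tensors.

Section CoinvolutiveBialgebra.
Variables (R : realType) (M : falgType R[i]).
Local Notation n := (\dim (fullv : {vspace M})).
Local Notation C := R[i].
Local Notation T := 'M[C]_n.
Variables (s : M -> M) (D : M -> T) (S : M -> M).
Hypotheses (bialg : gen_coinv_cstar_bialgebra s D S) (counital_DS : counital D S).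

Local Notation e := (unitD D).
Local Notation et := (eps_t D S).
Local Notation es := (eps_s D S).

Lemma DP : linear D. Proof. by case: bialg => _ []. Qed.
Lemma D_inj : injective D. Proof. by case: bialg => _ []. Qed.
Lemma DM x y : D (x * y) = tmul (D x) (D y). Proof. by case: bialg => _ []. Qed.
Lemma D_star x : D (s x) = tstar s (D x). Proof. by case: bialg => _ []. Qed.
Lemma SP : linear S. Proof. by case: bialg => _ _ []. Qed.
Lemma S1 : S 1 = 1. Proof. by case: bialg => _ _ []. Qed.
Lemma SM x y : S (x * y) = S y * S x. Proof. by case: bialg => _ _ []. Qed.
Lemma SK : involutive S. Proof. by case: bialg. Qed.
Lemma DS x : D (S x) = tflip (tmap S S (D x)).
Proof. by case: bialg => _ _ _ _ ->; rewrite tflipK. Qed.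
Lemma s_antilinear a x y : s (a *: x + y) = conjc a *: s x + s y.
Proof. by case: bialg => [[[]]]. Qed.
Lemma sK : involutive s. Proof. by case: bialg => [[[]]]. Qed.

Lemma eps_t_Nt x : in_Nt D (et x). Proof. by case: counital_DS. Qed.
Lemma tmap_eps_t_Ns y : in_Ns D y -> tmap id et (D y) = tmul e (tens y 1).
Proof. by case: counital_DS => _ _; apply. Qed.

Lemma eps_tP : linear et.
Proof. by move=> a x y; rewrite /eps_t DP tmapP tmuP. Qed.
Lemma eps_sP : linear es.
Proof. by move=> a x y; rewrite /eps_s DP tmapP tmuP. Qed.

Ltac linearity := let a := fresh "a" in let X := fresh "X" in let Y := fresh "Y" in
  by move=> a X Y /=; rewrite ?(tensPl, tensPr, tmulPl, tmulPr, tflipP, tmapP, tmuP,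
                             id_tens_funP, fun_tens_idP, DP, SP, eps_tP,
                             mulrDl, mulrDr, scalerAl, scalerAr).

Lemma tmulDe x : tmul (D x) e = D x. Proof. by rewrite -DM mulr1. Qed.
Lemma tmuleD x : tmul e (D x) = D x. Proof. by rewrite -DM mul1r. Qed.

Lemma DM_Nt x z : in_Nt D z -> D (x * z) = tmul (D x) (tens z 1).
Proof. by case=> zl _; rewrite DM zl -tmulA tmulDe. Qed.

Lemma DM_Ns x y : in_Ns D y -> D (x * y) = tmul (D x) (tens 1 y).
Proof. by case=> yl _; rewrite DM yl -tmulA tmulDe. Qed.

Lemma DM_Nsl y x : in_Ns D y -> D (y * x) = tmul (tens 1 y) (D x).
Proof. by case=> _ yr; rewrite DM yr tmulA tmuleD. Qed.

Lemma Ns1 : in_Ns D 1.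
Proof. by split; rewrite ?tmulr1 ?tmul1r. Qed.

Lemma tmap_SS_unit : tmap S S e = tflip e.
Proof. by rewrite /unitD -[in RHS]S1 DS tflipK. Qed.

Lemma tflip_tmap_SS_unit_tens (a b : M) :
  tflip (tmap S S (tmul e (tens a b))) = tmul (tens (S b) (S a)) e.
Proof.
by rewrite (tmap_antimul SP SM) tmap_SS_unit (tmap_tens SP SP) tflip_tmul tflipK tflip_tens.
Qed.

Lemma tflip_tmap_SS_tens_unit (a b : M) :
  tflip (tmap S S (tmul (tens a b) e)) = tmul e (tens (S b) (S a)).
Proof.
by rewrite (tmap_antimul SP SM) tmap_SS_unit (tmap_tens SP SP) tflip_tmul tflipK tflip_tens.
Qed.

Lemma S_Nt z : in_Nt D z -> in_Ns D (S z).
Proof.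
case=> zl zr; split.
- by rewrite DS zr tflip_tmap_SS_tens_unit S1.
- by rewrite DS zl tflip_tmap_SS_unit_tens S1.
Qed.

Lemma tmap_eps_t_unit : tmap id et e = e.
Proof. by rewrite tmap_eps_t_Ns ?tmulr1 //; exact: Ns1. Qed.

Lemma eps_tM_Ns y w : in_Ns D y -> et (y * w) = et w * S y.
Proof.
move=> Ns_y; rewrite /eps_t (DM_Nsl _ Ns_y); move: (D w).
apply: (tens_ext (f := fun A => _) (g := fun A => _)) => [||a b] /=; try linearity.
by rewrite tmul_tens !(tmap_tens linear_id SP) !tmu_tens mul1r SM mulrA.
Qed.

Lemma unit_tens_Ns y : in_Ns D y -> tmul e (tens y 1) = tmul e (tens 1 (S y)).
Proof.
move=> Ns_y; rewrite -(tmap_eps_t_Ns Ns_y) Ns_y.2 -[in RHS]tmap_eps_t_unit.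
move: e; apply: (tens_ext (f := fun A => _) (g := fun A => _)) => [||a b] /=; try linearity.
by rewrite !tmul_tens !(tmap_tens linear_id eps_tP) tmul_tens mul1r mulr1 eps_tM_Ns.
Qed.

Lemma unit_tens_Nt z : in_Nt D z -> tmul e (tens 1 z) = tmul e (tens (S z) 1).
Proof. by move=> Nt_z; rewrite (unit_tens_Ns (S_Nt Nt_z)) SK. Qed.

Lemma eps_tM_Nt x z : in_Nt D z -> et (x * z) = et (x * S z).
Proof.
move=> Nt_z; rewrite /eps_t (DM_Nt _ Nt_z) (DM_Ns _ (S_Nt Nt_z)); move: (D x).
apply: (tens_ext (f := fun A => _) (g := fun A => _)) => [||a b] /=; try linearity.
by rewrite !tmul_tens !(tmap_tens linear_id SP) !tmu_tens !mulr1 SM SK mulrA.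
Qed.

Lemma eps_tM_eps_t x y : et (x * y) = et (x * et y).
Proof.
rewrite {2}/eps_t (DM_Nt _ (eps_t_Nt y)) /eps_t DM; move: (D x) (D y) => A B.
move: A; apply: (tens_ext (f := fun A => _) (g := fun A => _)) => [||a b] /=; try linearity.
move: B; apply: (tens_ext (f := fun B => _) (g := fun B => _)) => [||c d] /=; try linearity.
by rewrite !tmul_tens !(tmap_tens linear_id SP) !tmu_tens mulr1 SM !mulrA.
Qed.

Lemma Nt_Ns_commute z y : in_Nt D z -> in_Ns D y -> z * y = y * z.
Proof.
move=> Nt_z Ns_y; apply: D_inj.
by rewrite (DM_Ns _ Ns_y) (DM_Nt _ Nt_z) Nt_z.1 Ns_y.1 !tmulA !tmul_tens !mul1r !mulr1.
Qed.

Lemma tflip_tmap_SS_tmap_eps_t (A : T) :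
  tflip (tmap S S (tmap id et (tflip (tmap S S A)))) = tmap es id A.
Proof.
move: A; apply: (tens_ext (f := fun A => _) (g := fun A => _)) => [||a b] /=; try linearity.
rewrite (tmap_tens SP SP) tflip_tens (tmap_tens linear_id eps_tP) (tmap_tens SP SP).
rewrite tflip_tens (tmap_tens eps_sP linear_id) SK; congr tens.
rewrite /eps_t /eps_s DS; move: (D a).
apply: (tens_ext (f := fun A => _) (g := fun A => _)) => [||c d] /=; try linearity.
rewrite (tmap_tens SP SP) tflip_tens (tmap_tens linear_id SP) (tmap_tens SP linear_id).
by rewrite !tmu_tens SM !SK.
Qed.

Section Counit.
Variables (th : M -> C) (th_lin : scalar th).

(* The paper's counit is θ_t ∘ ε_t; only the linearity of θ_t matters. *)
Definition counit x := th (et x).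

Lemma counitP : scalar counit.
Proof. by move=> a x y; rewrite /counit eps_tP th_lin. Qed.

Lemma counit_mulr_scalar w : scalar (fun m => counit (m * w)).
Proof. by move=> a u v; rewrite mulrDl -scalerAl counitP. Qed.

Lemma counitM_eps_t x y : counit (x * y) = counit (x * et y).
Proof. by rewrite /counit eps_tM_eps_t. Qed.

Lemma counitM_Nt x z : in_Nt D z -> counit (x * z) = counit (x * S z).
Proof. by move=> Nt_z; rewrite /counit eps_tM_Nt. Qed.

Hypothesis counit_right : forall x, id_tens_fun counit (D x) = x.

Lemma fun_tens_id_counitS x : fun_tens_id (fun m => counit (S m)) (D x) = x.
Proof.
apply: (can_inj SK).
by rewrite -(fun_tens_id_tmap (D x) counitP SP SP) -id_tens_fun_tflip -DS counit_right.
Qed.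

Lemma counitS x : counit (S x) = counit x.
Proof.
have counitS_lin : scalar (fun m => counit (S m)) by move=> a u v; rewrite SP counitP.
rewrite -{1}(counit_right x) (fun_tens_funE _ counitS_lin).
by rewrite -(fun_tens_fun_idE _ counitP) fun_tens_id_counitS.
Qed.

Lemma counit_left x : fun_tens_id counit (D x) = x.
Proof. by rewrite -[RHS]fun_tens_id_counitS; apply: eq_fun_tens_id => m; rewrite counitS. Qed.

Lemma counit_star x : counit (s x) = conjc (counit x).
Proof.
pose counit' m := conjc (counit (s m)).
have counit'_lin : scalar counit'.
  by move=> a u v; rewrite /counit' s_antilinear counitP rmorphD rmorphM /= conjcK.
have right' : id_tens_fun counit' (D x) = x.
  by apply: (can_inj sK); rewrite -(id_tens_fun_tstar counitP _ s_antilinear) -D_star counit_right.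
have : counit' x = counit x.
  by rewrite -{1}(counit_left x) (fun_tens_fun_idE _ counit'_lin) -(fun_tens_funE _ counitP) right'.
by rewrite /counit' => <-; rewrite conjcK.
Qed.

Lemma counit_weak_mul x y :
  fun_tens_fun counit counit (tmul (tmul (tens x 1) e) (tens 1 y)) = counit (x * y).
Proof.
have slice_eps_t A : id_tens_fun counit (tmul A (tens 1 y)) =
                     id_tens_fun counit (tmul A (tens 1 (et y))).
  by rewrite !(id_tens_fun_tmul1r counitP); apply: eq_id_tens_fun => m; apply: counitM_eps_t.
rewrite -(fun_tens_funE _ counitP) slice_eps_t tmulA (unit_tens_Nt (eps_t_Nt y)).
rewrite (id_tens_fun_tmull1 counitP) (id_tens_fun_tmulr1 counitP) /unitD counit_right mul1r.
by rewrite -(counitM_Nt _ (eps_t_Nt y)) -counitM_eps_t.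
Qed.

(* a = (ε ⊗ id)((a ⊗ 1) e) is the slice of e against m ↦ ε (a m). *)
Lemma counit_Nt_faithful a : in_Nt D a -> (forall w, counit (a * w) = 0) -> a = 0.
Proof.
case=> _ ar a_null; rewrite -(counit_left a) ar (fun_tens_id_tmull1 counitP).
rewrite (eq_fun_tens_id _ a_null) /fun_tens_id big1 // => i _.
by rewrite big1 // => j _; rewrite mulr0 scale0r.
Qed.

(* Each row of (id ⊗ ε_t) P lies in N_t, where counit_Nt_faithful applies. *)
Lemma eq_tmap_eps_t (P Q : T) :
    (forall w, id_tens_fun (fun m => counit (m * w)) (tmap id et P) =
               id_tens_fun (fun m => counit (m * w)) (tmap id et Q)) ->
  tmap id et P = tmap id et Q.
Proof.
move=> PQ; apply/matrixP => k l.
have coord_lin j : scalar (coord (bM M) j) by exact: linearP.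
have row_tmap (A : T) : fun_tens_id (coord (bM M) k) (tmap id et A) =
                        et (fun_tens_id (coord (bM M) k) A).
  by rewrite (fun_tens_id_tmap _ (coord_lin k) linear_id eps_tP).
rewrite -!fun_tens_fun_coord -!(fun_tens_fun_idE _ (coord_lin l)) !row_tmap.
congr (coord _ l _); apply/eqP; rewrite -subr_eq0 -(linear_forB eps_tP); apply/eqP.
apply: counit_Nt_faithful; first exact: eps_t_Nt.
move=> w; have := congr1 (coord (bM M) k) (PQ w).
rewrite (fun_tens_funE _ (coord_lin k)) -(fun_tens_fun_idE _ (counit_mulr_scalar w)).
rewrite (fun_tens_funE _ (coord_lin k)) -(fun_tens_fun_idE _ (counit_mulr_scalar w)) !row_tmap.
by rewrite (linear_forB eps_tP) mulrBl (linear_forB counitP) => ->; rewrite subrr.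
Qed.

(* Both sides are of the form (id ⊗ ε_t) _, and both slices equal S (ε_t w) x. *)
Lemma tmap_eps_t_D x : tmap id et (D x) = tmul e (tens x 1).
Proof.
have e_x : tmap id et (tmul e (tens x 1)) = tmul e (tens x 1).
  by rewrite (tmap_id_tmul_tens1 _ _ eps_tP) tmap_eps_t_unit.
rewrite -[RHS]e_x; apply: eq_tmap_eps_t => w; rewrite e_x.
have Ns_Sw : in_Ns D (S (et w)) by apply: S_Nt; exact: eps_t_Nt.
have slide m : counit (et m * w) = counit (S (et w) * m).
  rewrite counitM_eps_t (counitM_Nt _ (eps_t_Nt w)).
  by rewrite (Nt_Ns_commute (eps_t_Nt m) Ns_Sw) -counitM_eps_t.
rewrite (id_tens_fun_tmap _ (counit_mulr_scalar w) eps_tP) (eq_id_tens_fun _ slide).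
rewrite -(id_tens_fun_tmul1l counitP) -(DM_Nsl _ Ns_Sw) counit_right.
rewrite (id_tens_fun_tmulr1 (counit_mulr_scalar w)).
rewrite (eq_id_tens_fun _ (fun m => counitM_eps_t m w)) -(id_tens_fun_tmul1r counitP).
by rewrite (unit_tens_Nt (eps_t_Nt w)) (id_tens_fun_tmulr1 counitP) /unitD counit_right mul1r.
Qed.

Lemma tmap_eps_s_D x : tmap es id (D x) = tmul (tens 1 x) e.
Proof. by rewrite -tflip_tmap_SS_tmap_eps_t -DS tmap_eps_t_D tflip_tmap_SS_unit_tens S1 SK. Qed.

Lemma counit_weak_kac : weak_kac_algebra s D S counit.
Proof.
exact: (conj bialg (conj counitP (conj counit_left (conj counit_right
         (conj counitS (conj counit_star (conj counit_weak_mul tmap_eps_s_D))))))).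
Qed.

End Counit.
End CoinvolutiveBialgebra.

Lemma theta_tP (R : realType) (M : falgType R[i])
    (D : M -> 'M[R[i]]_(\dim (fullv : {vspace M}))) :
  scalar (theta_t D).
Proof.
move=> a x y; rewrite /theta_t mulr_sumr -big_split; apply: eq_bigr => i _.
by rewrite mulrDl -scalerAl linearD linearZ.
Qed.

Theorem theorem2p6p1 (R : realType) (M : falgType R[i]) (s : M -> M)
    (D : M -> 'M[R[i]]_(\dim (fullv : {vspace M}))) (S : M -> M) :
  gen_coinv_cstar_bialgebra s D S ->
  counital D S ->
  (weak_kac_algebra s D S (fun x => theta_t D (eps_t D S x)) <->
   forall x, id_tens_fun (fun y => theta_t D (eps_t D S y)) (D x) = x).
Proof.
move=> bialg counital_DS; split=> [[_ [_ [_ []]]] // | counit_right].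
exact: (counit_weak_kac bialg counital_DS (theta_tP D) counit_right).
Qed.
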